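(* Let $T\in(0,\infty]$, $n\in\mathbb{N}$, $u_0\in\mathbb{R}^n$, let $A:\mathbb{R}\to\mathbb{R}^{n\times n}$ and $f:\mathbb{R}\to\mathbb{R}^n$ be continuous on $(0,\infty)$, and let $G$ be the solution of $$G'(t)+A(t)\,G(t)=0 \ \text{ on } (0,\infty),\qquad G(0)=\mathrm{Id}.$$ Let $\ell:\mathbb{R}\to\mathbb{R}^{n\times n}$ be continuous on $(0,\infty)$ and satisfy $$\mathrm{Id}=\int_0^T G^{-1}(s)\,\ell(s)\,ds\qquad\text{with}\qquad \ell(s)=0\ \text{ for } s>T,$$ and let $\ell^f:\mathbb{R}\to\mathbb{R}^n$ be continuous on $(0,\infty)$ and satisfy $\ell^f(s)=f(s)$ for $s>T$. Then the solution $u$ of $$u'(t)+A(t)\,u(t)=f(t)-\ell(t)\,u_0-\ell^f(t)\ \text{ on }(0,\infty),\qquad u(0)=u_0,$$ satisfies $u(t)=0$ for $t\ge T$ if and only if $\ell^f$ satisfies $$\int_0^T G^{-1}(s)\,[f(s)-\ell^f(s)]\,ds=0.$$ In particular, the unique solution $u$ is $C^1$ on $(0,\infty)$ and is given by $$u(t)=G(t)\left[\mathrm{Id}\,u_0+\int_0^t G^{-1}(s)\,\{f(s)-\ell(s)\,u_0-\ell^f(s)\}\,ds\right]\qquad\text{for } t\in(0,\infty).$$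
   Context: $\mathrm{Id}$ denotes the $n\times n$ identity matrix. $G(t)\in\mathbb{R}^{n\times n}$ is the fundamental matrix of the linear system, which exists uniquely and is invertible for every $t$; $G^{-1}(s)$ denotes the inverse matrix of $G(s)$.
   Formalization: For T=∞, where ''u(t)=0 for t≥T'' is vacuous and the equivalence false, it is replaced by G^{-1}(t)u(t)→0 as t→∞; existence of u (which can fail) is asserted only if the integral in the solution formula converges at 0; integrals are improper and u, G are right-continuous at 0. *)

(* Defs.v *)
From HB Require Import structures.
From mathcomp Require Import all_boot all_order all_algebra.
From mathcomp Require Import all_classical all_reals all_analysis.

Set Implicit Arguments.
Unset Strict Implicit.
Unset Printing Implicit Defensive.

Import Order.TTheory GRing.Theory Num.Theory.
Import numFieldNormedType.Exports.

Local Open Scope classical_set_scope.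
Local Open Scope ring_scope.

(* Functions are total on R, but only their values on [0, +oo[ matter.  Since
   the equation is imposed on ]0, +oo[ only, the initial value has to be
   attained continuously from the right. *)
Definition is_solution (R : realType) (n m : nat) (A : R -> 'M[R]_n)
    (F : R -> 'M[R]_(n, m)) (y0 : 'M[R]_(n, m)) (y : R -> 'M[R]_(n, m)) : Prop :=
  [/\ y 0 = y0,
      y t @[t --> 0^'+] --> y 0 &
      forall t : R, 0 < t ->
        derivable y t 1 /\ derive1 y t + A t *m y t = F t].

Definition C1_pos (R : realType) (n m : nat) (y : R -> 'M[R]_(n, m)) : Prop :=
  (forall t : R, 0 < t -> derivable y t 1) /\
  {in `]0, +oo[, continuous (derive1 y)}.

Definition mx_integral (R : realType) (n m : nat) (F : R -> 'M[R]_(n, m))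
    (a b : R) : 'M[R]_(n, m) :=
  \matrix_(i, j) \int[@lebesgue_measure R]_(s in `[a, b]) F s i j.

(* "The integral of F from 0 to T converges and equals I".  F is meant to be
   continuous on ]0, +oo[, so that the integrals over [a, b] with 0 < a are
   ordinary ones; F may be singular at 0, and the integral is improper there,
   and also at +oo when T = +oo. *)
Definition is_integral0 (R : realType) (n m : nat) (F : R -> 'M[R]_(n, m))
    (T : \bar R) (I : 'M[R]_(n, m)) : Prop :=
  match T with
  | b%:E => mx_integral F a b @[a --> 0^'+] --> I
  | +oo%E => exists2 J : R -> 'M[R]_(n, m),
      forall b : R, 0 < b -> mx_integral F a b @[a --> 0^'+] --> J b &
      J b @[b --> +oo] --> I
  | -oo%E => False
  end.

(* Main.v *)
Require Import Defs.
From HB Require Import structures.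
From mathcomp Require Import all_boot all_order all_algebra.
From mathcomp Require Import all_classical all_reals all_analysis.
From mathcomp Require Import ring lra.

Set Implicit Arguments.
Unset Strict Implicit.
Unset Printing Implicit Defensive.

Import Order.TTheory GRing.Theory Num.Theory.
Import numFieldNormedType.Exports.

Local Open Scope classical_set_scope.
Local Open Scope ring_scope.

(** The pullback w = G^-1 u of a solution satisfies w' = G^-1 F on ]0, +oo[ and
    tends to u0 at 0+, because G and u are right-continuous at 0 and G(0) = Id.
    So w is an antiderivative of the continuous function G^-1 F, and the
    integral of G^-1 F over [a, b] is w(b) - w(a); letting a tend to 0+ shows
    that the improper integral up to t exists and equals w(t) - u0. This is the
    variation-of-constants formula, and uniqueness of u follows from it.
    Conversely, when the improper integrals of G^-1 F exist, so does the limit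
    at 0+ of an antiderivative, and the formula defines a solution
    ([pushforward_solution]).

    Improper integrals are handled through antiderivatives throughout: if P is
    an antiderivative of g on ]0, +oo[, then the integral of g from 0 to b
    exists exactly when P has a limit at 0+, and the integral up to +oo when P
    also has a limit at +oo ([is_integral0_finP], [is_integral0_pinftyP]). For
    the control criterion let L be an antiderivative of G^-1 l. Since
    F = f - l u0 - lf, the function Q = L u0 + w is an antiderivative of
    G^-1 (f - lf). For finite T the hypothesis on l says that L tends to
    L(T) - Id at 0+, hence Q tends to L(T) u0 - u0 + u0 = Q(T) - w(T), and the
    integral of G^-1 (f - lf) from 0 to T equals w(T). It vanishes if and only
    if u(T) = 0, and u then stays zero because F = 0 after T makes w constant
    there. For T = +oo the same computation compares the limits at +oo.

    That G(s) is invertible for s > 0 is the one point where the differential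
    equation has to be estimated: a vector v with G(s) v = 0 would give a
    solution G v of the homogeneous equation vanishing at s, hence on ]0, s]
    ([homogeneous_eq0_before]), although it tends to v at 0+. *)

(** * Limits and inverses of matrix-valued functions *)

Lemma near_cvg_to {T : Type} {U : nbhsType} {F : set_system T} {FF : Filter F}
    (f g : T -> U) (l : U) :
  (\forall x \near F, f x = g x) -> f x @[x --> F] --> l ->
  g x @[x --> F] --> l.
Proof.
move=> fg; apply: cvg_trans; apply: near_eq_cvg.
by apply: filterS fg.
Qed.

Section MatrixLimits.
Context {R : realType} {T : Type} {F : set_system T} {FF : Filter F}.

Lemma cvg_mxP (m n : nat) (M : T -> 'M[R]_(m, n)) (L : 'M[R]_(m, n)) :
  M x @[x --> F] --> L <-> forall i j, M x i j @[x --> F] --> L i j.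
Proof.
split=> [ML i j|ML].
  exact: (cvg_comp _ _ ML (@coord_continuous R m n i j L)).
move=> B [P LP PB].
have: \forall x \near F, forall i j, P i j (M x i j).
  by apply: filter_forall => i; apply: filter_forall => j; apply: ML; apply: LP.
by apply: filterS => x PMx; exact: PB.
Qed.

Lemma cvg_mulmx (m n p : nat) (M : T -> 'M[R]_(m, n)) (N : T -> 'M[R]_(n, p))
    (L : 'M[R]_(m, n)) (K : 'M[R]_(n, p)) :
  M x @[x --> F] --> L -> N x @[x --> F] --> K ->
  M x *m N x @[x --> F] --> L *m K.
Proof.
move=> /cvg_mxP ML /cvg_mxP NK; apply/cvg_mxP => i j; rewrite mxE.
under eq_cvg do rewrite mxE.
apply: cvg_big => [|k _]; first exact: add_continuous.
exact: cvgM.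
Qed.

Lemma cvg_det (n : nat) (M : T -> 'M[R]_n) (L : 'M[R]_n) :
  M x @[x --> F] --> L -> \det (M x) @[x --> F] --> \det L.
Proof.
move=> /cvg_mxP ML.
apply: (@cvg_big R) => [|s _]; first exact: add_continuous.
apply: cvgMl_tmp; apply: (@cvg_big R) => [|i _]; first exact: mul_continuous.
exact: ML.
Qed.

Lemma near_unitmx (n : nat) (M : T -> 'M[R]_n) (L : 'M[R]_n) : L \in unitmx ->
  M x @[x --> F] --> L -> \forall x \near F, M x \in unitmx.
Proof.
rewrite unitmxE unitfE => detL ML.
under eq_near do rewrite unitmxE unitfE.
exact: cvgr_neq0 (cvg_det ML) detL.
Qed.

Lemma cvg_invmx (n : nat) (M : T -> 'M[R]_n) (L : 'M[R]_n) : L \in unitmx ->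
  M x @[x --> F] --> L -> invmx (M x) @[x --> F] --> invmx L.
Proof.
move=> Lu ML.
(* invmx M is M itself when M is singular, so Cramer's formula is used only
   near the limit. *)
have adjM : (\det (M x))^-1 *: \adj (M x) @[x --> F] --> invmx L.
  rewrite /invmx Lu; apply: cvgZ.
    by apply: cvgV; [move: Lu; rewrite unitmxE unitfE|exact: cvg_det].
  apply/cvg_mxP => i j; under eq_cvg do rewrite mxE; rewrite mxE.
  apply: cvgMl_tmp; apply: (@cvg_det n.-1); apply/cvg_mxP => k l.
  under eq_cvg do rewrite !mxE; rewrite !mxE.
  by move/cvg_mxP : ML; exact.
apply: (near_cvg_to _ adjM).
by apply: filterS (near_unitmx Lu ML) => x; rewrite /invmx => ->.
Qed.

End MatrixLimits.

Lemma mx_cvg_unique (R : realType) {T : Type} {F : set_system T}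
    {FF : ProperFilter F} (m n : nat) (M : T -> 'M[R]_(m, n))
    (L K : 'M[R]_(m, n)) :
  M x @[x --> F] --> L -> M x @[x --> F] --> K -> L = K.
Proof. by move=> ML MK; exact: (norm_cvg_unique ML MK). Qed.

(** * Derivatives of matrix-valued functions *)

Section MatrixDerivatives.
Context {R : realType}.

(** The form of the derivative in which the matrix product and inverse rules can
    be read off: both sides of the limit are plain matrix expressions. *)
Lemma is_derive1P (V : normedModType R) (f : R -> V) (t : R) (df : V) :
  is_derive t 1 f df <-> h^-1 *: (f (h + t) - f t) @[h --> 0^'] --> df.
Proof.
have -> : (fun h : R => h^-1 *: (f (h + t) - f t)) =
    (fun h => h^-1 *: ((f \o shift t) (h *: 1) - f t)).
  by apply/funext => h /=; rewrite [_ *: 1]mulr1.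
split=> [[dft <-]|fl]; first exact: dft.
by apply: DeriveDef; [apply/cvg_ex; exists df|exact: cvg_lim fl].
Qed.

Lemma is_derive_continuous (V : normedModType R) (f : R -> V) (t : R) (df : V) :
  is_derive t 1 f df -> {for t, continuous f}.
Proof. by case=> /derivable1_diffP /differentiable_continuous. Qed.

Lemma cvg_shift_dnbhs (U : topologicalType) (f : R -> U) (t : R) :
  {for t, continuous f} -> f (h + t) @[h --> 0^'] --> f t.
Proof.
move=> ft; apply: cvg_within_filter.
have sh : h + t @[h --> (0 : R)] --> t.
  by rewrite -[X in _ --> X]add0r; apply: cvgD; [exact: cvg_id|exact: cvg_cst].
exact: (cvg_comp _ _ sh ft).
Qed.

Lemma is_derive_mulmx (m n p : nat) (M : R -> 'M[R]_(m, n))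
    (N : R -> 'M[R]_(n, p)) (t : R)
    (dM : 'M[R]_(m, n)) (dN : 'M[R]_(n, p)) :
  is_derive t 1 M dM -> is_derive t 1 N dN ->
  is_derive t 1 (fun x => M x *m N x) (dM *m N t + M t *m dN).
Proof.
move=> Mt Nt; have cN := cvg_shift_dnbhs (is_derive_continuous Nt).
move: Mt Nt => /is_derive1P Mt /is_derive1P Nt; apply/is_derive1P.
have H : h^-1 *: (M (h + t) - M t) *m N (h + t) +
    M t *m (h^-1 *: (N (h + t) - N t)) @[h --> 0^'] --> dM *m N t + M t *m dN.
  by apply: cvgD; apply: cvg_mulmx => //; exact: cvg_cst.
apply: (near_cvg_to _ H); near=> h; rewrite /= -scalemxAl -scalemxAr.
by rewrite -scalerDr mulmxBl mulmxBr addrA subrK.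
Unshelve. all: by end_near. Qed.

(** Since X^-1 - Y^-1 = - X^-1 (X - Y) Y^-1, the difference quotient of the
    inverse is a product of factors whose limits are known; this uses the
    continuity of the inverse, not the derivatives of its entries. *)
Lemma is_derive_invmx (n : nat) (M : R -> 'M[R]_n) (t : R) (dM : 'M[R]_n) :
  M t \in unitmx -> is_derive t 1 M dM ->
  is_derive t 1 (fun x => invmx (M x)) (- (invmx (M t) *m dM *m invmx (M t))).
Proof.
move=> Mu Mt; have cM := cvg_shift_dnbhs (is_derive_continuous Mt).
move: Mt => /is_derive1P Mt; apply/is_derive1P.
have H : - (invmx (M (h + t)) *m (h^-1 *: (M (h + t) - M t)) *m invmx (M t))
    @[h --> 0^'] --> - (invmx (M t) *m dM *m invmx (M t)).
  apply: cvgN; apply: cvg_mulmx; last exact: cvg_cst.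
  by apply: cvg_mulmx => //; exact: cvg_invmx.
apply: (near_cvg_to _ H).
apply: filterS (near_unitmx Mu cM) => h Mhu /=.
rewrite -scalemxAr -scalemxAl -scalerN; congr (_ *: _).
rewrite mulmxBr mulVmx// mulmxBl mul1mx -mulmxA mulmxV// mulmx1.
by rewrite opprB.
Qed.

Lemma is_derive_mxP (m n : nat) (M : R -> 'M[R]_(m, n)) (t : R)
    (dM : 'M[R]_(m, n)) :
  is_derive t 1 M dM <-> forall i j, is_derive t 1 (fun x => M x i j) (dM i j).
Proof.
split=> [/is_derive1P /cvg_mxP H i j|H]; apply/is_derive1P.
  by apply: (near_cvg_to _ (H i j)); near=> h; rewrite !mxE.
apply/cvg_mxP => i j; have /is_derive1P Hij := H i j.
by apply: (near_cvg_to _ Hij); near=> h; rewrite !mxE.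
Unshelve. all: by end_near. Qed.

End MatrixDerivatives.

(** * Antiderivatives and improper integrals on ]0, +oo[ *)

Section Primitives.
Context {R : realType}.

Definition continuous_pos (U : topologicalType) (g : R -> U) :=
  forall t : R, 0 < t -> {for t, continuous g}.

Definition primitive_pos (V : normedModType R) (P g : R -> V) :=
  forall t : R, 0 < t -> is_derive t 1 P (g t).

Lemma continuous_pos_within (U : topologicalType) (g : R -> U) (a b : R) :
  continuous_pos g -> 0 < a -> {within `[a, b], continuous g}.
Proof.
move=> cg a0; apply: continuous_in_subspaceT => x.
rewrite inE /= in_itv /= => /andP[ax _]; apply: cg.
exact: lt_le_trans ax.
Qed.

Lemma continuous_pos_integrable (g : R -> R) (a b : R) :
  continuous_pos g -> 0 < a ->
  (@lebesgue_measure R).-integrable `[a, b] (EFin \o g).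
Proof.
move=> cg a0; apply: continuous_compact_integrable.
  exact: segment_compact.
exact: continuous_pos_within.
Qed.

(** As g may be singular at 0, the antiderivative is based at 1: it is the
    oriented integral from 1 to t, the integral over an empty interval being 0.
    Near t it differs by a constant from the integral based at a point c with
    0 < c < min(t, 1), to which the fundamental theorem applies. *)
Lemma exists_real_primitive_pos (g : R -> R) :
  continuous_pos g -> exists P : R -> R, primitive_pos P g.
Proof.
move=> cg.
pose I (a b : R) := \int[@lebesgue_measure R]_(s in `[a, b]) g s.
have I_ge a b : b <= a -> I a b = 0.
  rewrite le_eqVlt => /predU1P[->|ba].
    by rewrite /I set_itv1 Rintegral_set1.
  by rewrite /I set_itv_ge ?Rintegral_set0// bnd_simp -ltNge.
have I_sub c a b : 0 < c -> c <= a -> a <= b -> I c b - I c a = I a b.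
  move=> c0 ca ab; rewrite /I (@Rintegral_itvB R g (BLeft c) (BRight b) a).
  - apply: Rintegral_itv_obnd_cbnd.
    have := continuous_pos_integrable b cg (lt_le_trans c0 ca).
    apply: integrableS => //.
    exact: subset_itv_oc_cc.
  - exact: continuous_pos_integrable.
  - by rewrite bnd_simp.
  - by rewrite bnd_simp.
exists (fun t => I 1 t - I t 1) => t t0.
pose c := Num.min t 1 / 2.
have m0 : 0 < Num.min t 1 by rewrite lt_min t0 ltr01.
have c0 : 0 < c by rewrite divr_gt0.
have cm : c < Num.min t 1 by rewrite ltr_pdivrMr// mulrDr mulr1 ltrDl.
have [ct c1] : c < t /\ c < 1 by move: cm; rewrite lt_min => /andP[].
have [dIt It] : derivable (I c) t 1 /\ derive1 (I c) t = g t.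
  apply: (@continuous_FTC1_closed R g c t (t + 1)) => //.
  - by rewrite ltrDl.
  - exact: continuous_pos_integrable.
  - exact: cg.
have Pt : is_derive t 1 (fun x => I c x - I c 1) (g t).
  have It' : is_derive t 1 (I c) (g t) by apply: DeriveDef; rewrite -?derive1E.
  apply: (is_derive_eq (is_deriveB It' (is_derive_cst (I c 1) t 1))).
  by rewrite subr0.
apply: near_eq_is_derive Pt; near=> x.
have cx : c < x by near: x; exact: lt_nbhsr.
have [x1|x1] := leP x 1.
  rewrite (I_ge 1 x)// sub0r -(I_sub c x 1)//; last exact: ltW.
  by rewrite opprB.
by rewrite (I_ge x 1) ?ltW// subr0 -(I_sub c 1 x)//; exact: ltW.
Unshelve. all: by end_near. Qed.

Lemma Rintegral_primitive_pos (P g : R -> R) (a b : R) :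
  continuous_pos g -> primitive_pos P g -> 0 < a -> a <= b ->
  \int[@lebesgue_measure R]_(s in `[a, b]) g s = P b - P a.
Proof.
move=> cg Pg a0; rewrite le_eqVlt => /predU1P[<-|ab].
  by rewrite set_itv1 Rintegral_set1 subrr.
have P_cont t : 0 < t -> {for t, continuous P}.
  by move=> t0; exact: is_derive_continuous (Pg _ t0).
rewrite /Rintegral (@continuous_FTC2 R g P)//.
- exact: continuous_pos_within.
- split.
  + by move=> x /[!in_itv]/= /andP[ax _]; case: (Pg x (lt_trans a0 ax)).
  + by apply: cvg_at_right_filter; exact: P_cont.
  + by apply: cvg_at_left_filter; apply: P_cont; exact: lt_trans ab.
- move=> x /[!in_itv]/= /andP[ax _]; rewrite derive1E.
  by case: (Pg x (lt_trans a0 ax)).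
Qed.

Lemma continuous_pos_coord (m n : nat) (g : R -> 'M[R]_(m, n)) i j :
  continuous_pos g -> continuous_pos (fun x => g x i j).
Proof. by move=> cg t t0; have /cvg_mxP := cg t t0; exact. Qed.

Lemma exists_primitive_pos (m n : nat) (g : R -> 'M[R]_(m, n)) :
  continuous_pos g -> exists P : R -> 'M[R]_(m, n), primitive_pos P g.
Proof.
move=> cg.
pose Pij i j :=
  cid (exists_real_primitive_pos (continuous_pos_coord (i := i) (j := j) cg)).
exists (fun x => \matrix_(i, j) sval (Pij i j) x) => t t0.
apply/is_derive_mxP => i j; under eq_fun do rewrite mxE.
exact: (svalP (Pij i j)).
Qed.

Lemma mx_integral_primitive_pos (m n : nat) (P g : R -> 'M[R]_(m, n))
    (a b : R) :
  continuous_pos g -> primitive_pos P g -> 0 < a -> a <= b ->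
  mx_integral g a b = P b - P a.
Proof.
move=> cg Pg a0 ab; apply/matrixP => i j; rewrite !mxE.
rewrite (@Rintegral_primitive_pos (fun x => P x i j))//.
  exact: continuous_pos_coord.
by move=> t t0; have /is_derive_mxP := Pg t t0; exact.
Qed.

Lemma near_mx_integral_primitive (m n : nat) (P g : R -> 'M[R]_(m, n)) (b : R) :
  continuous_pos g -> primitive_pos P g -> 0 < b ->
  \forall a \near 0^'+, mx_integral g a b = P b - P a.
Proof.
move=> cg Pg b0; near=> a; apply: mx_integral_primitive_pos => //.
by near: a; exact: nbhs_right_le.
Unshelve. all: by end_near. Qed.

Lemma cvg_primitive_integral (m n : nat) (P g : R -> 'M[R]_(m, n)) (b : R)
    (P0 : 'M[R]_(m, n)) :
  continuous_pos g -> primitive_pos P g -> 0 < b ->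
  P a @[a --> 0^'+] --> P0 <->
  mx_integral g a b @[a --> 0^'+] --> P b - P0.
Proof.
move=> cg Pg b0; have E := near_mx_integral_primitive cg Pg b0.
split=> [PP0|gI].
  have H : P b - P a @[a --> 0^'+] --> P b - P0.
    by apply: cvgB => //; exact: cvg_cst.
  by apply: (near_cvg_to _ H); apply: filterS E.
have H : P b - mx_integral g a b @[a --> 0^'+] --> P b - (P b - P0).
  by apply: cvgB => //; exact: cvg_cst.
rewrite subKr in H; apply: (near_cvg_to _ H); apply: filterS E => a ->.
by rewrite subKr.
Qed.

(** Turns a statement on improper integrals into one on the limit at 0+ of an
    antiderivative that can be chosen freely, for instance G^-1 u. *)
Lemma is_integral0_finP (m n : nat) (P g : R -> 'M[R]_(m, n)) (b : R)
    (I : 'M[R]_(m, n)) :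
  continuous_pos g -> primitive_pos P g -> 0 < b ->
  is_integral0 g b%:E I <-> P a @[a --> 0^'+] --> P b - I.
Proof.
move=> cg Pg b0 /=.
by rewrite (cvg_primitive_integral (P b - I) cg Pg b0) subKr.
Qed.

Lemma is_integral0_pinftyP (m n : nat) (P g : R -> 'M[R]_(m, n))
    (I : 'M[R]_(m, n)) :
  continuous_pos g -> primitive_pos P g ->
  is_integral0 g +oo I <->
  exists2 P0 : 'M[R]_(m, n),
    P a @[a --> 0^'+] --> P0 & P b @[b --> +oo] --> P0 + I.
Proof.
move=> cg Pg /=; split=> [[J gJ JI]|[P0 PP0 PI]].
  have PP0 b : 0 < b -> P a @[a --> 0^'+] --> P b - J b.
    by move=> b0; apply/(is_integral0_finP (J b) cg Pg b0); exact: gJ.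
  exists (P 1 - J 1); first exact: PP0.
  have H : (P 1 - J 1) + J b @[b --> +oo] --> (P 1 - J 1) + I.
    by apply: cvgD => //; exact: cvg_cst.
  apply: (near_cvg_to _ H); near=> b.
  have b0 : 0 < b by near: b; exact: nbhs_pinfty_gt.
  (* P b - J b is the limit of P at 0+, whatever b is. *)
  have -> : P 1 - J 1 = P b - J b.
    exact: mx_cvg_unique (PP0 1 ltr01) (PP0 b b0).
  by rewrite subrK.
exists (fun b => P b - P0).
  by move=> b b0; apply/(cvg_primitive_integral P0 cg Pg b0).
have -> : I = P0 + I - P0 by rewrite addrC addKr.
by apply: cvgB => //; exact: cvg_cst.
Unshelve. all: by end_near. Qed.

End Primitives.

(** * Invertibility of the fundamental matrix *)

Section Energy.
Context {R : realType}.

Lemma coord_le_mx_norm (m n : nat) (M : 'M[R]_(m, n)) i j : `|M i j| <= `|M|.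
Proof.
by rewrite [leRHS]/Num.Def.normr/= mx_normrE; exact: (le_bigmax _ _ (i, j)).
Qed.

(** With q = |v|^2, the first sum is q' along v' = - A v. Expanding both terms
    into sums over (i, j), the claim follows from the termwise inequality
    2 v_i A_ij v_j <= K (v_i^2 + v_j^2). *)
Lemma energy_derivative_ge0 (n : nat) (A : 'M[R]_n) (v : 'cV[R]_n) (K : R) :
  (forall i j, `|A i j| <= K) ->
  0 <= \sum_i 2 * v i 0 * (- (A *m v)) i 0 +
       2 * n%:R * K * \sum_i v i 0 ^+ 2.
Proof.
move=> AK.
have -> : 2 * n%:R * K * \sum_i v i 0 ^+ 2 =
    \sum_i \sum_j (K * v i 0 ^+ 2 + K * v j 0 ^+ 2).
  have inner i : \sum_j (K * v i 0 ^+ 2 + K * v j 0 ^+ 2) =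
      n%:R * K * v i 0 ^+ 2 + K * \sum_j v j 0 ^+ 2.
    rewrite big_split /= sumr_const card_ord -mulr_sumr -mulr_natl; ring.
  rewrite (eq_bigr _ (fun i _ => inner i)) big_split /= sumr_const card_ord.
  rewrite -mulr_sumr -mulr_natl; ring.
rewrite -big_split /=; apply: sumr_ge0 => i _.
rewrite !mxE -sumrN mulr_sumr -big_split /=; apply: sumr_ge0 => j _.
(* K (x^2 + y^2) - 2 a x y = ((K - a) (x + y)^2 + (K + a) (x - y)^2) / 2 *)
have := AK i j; rewrite ler_norml => /andP[K1 K2].
have KB : 0 <= K - A i j by lra.
have KD : 0 <= K + A i j by lra.
have := mulr_ge0 KB (sqr_ge0 (v i 0 + v j 0)).
have := mulr_ge0 KD (sqr_ge0 (v i 0 - v j 0)).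
lra.
Qed.

(** Backward uniqueness, by an energy estimate on the compact interval [t, s],
    where A is bounded: for k large, exp(k x) |y(x)|^2 is nondecreasing in x.
    It is nonnegative and vanishes at s. *)
Lemma homogeneous_eq0_before (n : nat) (A : R -> 'M[R]_n) (y : R -> 'cV[R]_n)
    (s : R) :
  continuous_pos A -> primitive_pos y (fun t => - (A t *m y t)) ->
  y s = 0 -> forall t, 0 < t -> t <= s -> y t = 0.
Proof.
move=> cA yA ys0 t t0 ts.
have [c _ Ac] : exists2 c, c \in `[t, s] &
    forall x, x \in `[t, s] -> `|A x| <= `|A c|.
  apply: (@EVT_max R (fun x => `|A x|)) => //.
  apply: continuous_pos_within t0 => x x0.
  by apply: cvg_norm; exact: cA.
pose k : R := 2 * n%:R * `|A c|.
pose yi i : R -> R := fun x => y x i 0.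
pose q : R -> R := \sum_(i < n) (yi i * yi i).
pose e : R -> R := fun x => expR (k * x).
have qE x : q x = \sum_i y x i 0 ^+ 2.
  by rewrite /q fct_sumE; apply: eq_bigr => i _; rewrite expr2.
pose dq (x : R) : R := \sum_(i < n) (yi i x *: (- (A x *m y x)) i 0 +
                         yi i x *: (- (A x *m y x)) i 0).
have Dq (x : R) : 0 < x -> is_derive x 1 q (dq x).
  move=> x0; apply: is_derive_sum => i; apply: is_deriveM.
  - by have /is_derive_mxP := yA x x0; exact.
  - by have /is_derive_mxP := yA x x0; exact.
have De (x : R) : is_derive x 1 e (k * e x).
  have Dk : is_derive x 1 (fun x : R => k * x) k.
    by apply: (is_derive_eq (is_deriveZ k (is_derive_id x 1))); exact: mulr1.
  apply: (is_derive_eq (is_derive1_comp (is_derive_expR (k * x)) Dk)).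
  exact: mulrC.
pose E : R -> R := fun x => e x * q x.
have DE (x : R) : 0 < x -> is_derive x 1 E (e x * (dq x + k * q x)).
  move=> x0; apply: (is_derive_eq (is_deriveM (De x) (Dq x x0))).
  by rewrite /GRing.scale /=; ring.
have E_ndecr : E t <= E s.
  apply: (@ger0_derive1_ndecr R E t s _ _ _ t s (lexx t) ts (lexx s)).
  - move=> x /[!in_itv]/= /andP[tx _].
    by case: (DE x (lt_trans t0 tx)).
  - move=> x /[!in_itv]/= /andP[tx xs].
    rewrite derive1E; case: (DE x (lt_trans t0 tx)) => _ ->.
    rewrite mulr_ge0 ?expR_ge0// qE.
    have -> : dq x = \sum_i 2 * y x i 0 * (- (A x *m y x)) i 0.
      by apply: eq_bigr => i _; rewrite /yi /GRing.scale /=; ring.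
    apply: energy_derivative_ge0 => i j.
    apply: le_trans (coord_le_mx_norm _ _ _) (Ac _ _).
    by rewrite in_itv /= !ltW.
  - apply: derivable_within_continuous => x /[!in_itv]/= /andP[tx _].
    by case: (DE x (lt_le_trans t0 tx)).
have qt : q t = 0.
  apply/eqP; rewrite eq_le; apply/andP; split; last first.
    by rewrite qE sumr_ge0// => i _; exact: sqr_ge0.
  have : e t * q t <= 0.
    have qs : q s = 0 by rewrite qE big1// => i _; rewrite ys0 mxE expr0n.
    by move: E_ndecr; rewrite /E qs mulr0.
  by rewrite pmulr_rle0// expR_gt0.
apply/colP => i; rewrite mxE; apply/eqP; rewrite -sqrf_eq0.
move: qt; rewrite qE => /eqP.
rewrite psumr_eq0 => [/allP /(_ i)|j _]; last exact: sqr_ge0.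
by rewrite mem_index_enum => /(_ isT).
Qed.

(** If G(s) v = 0, then y = G v solves the homogeneous equation and y(s) = 0,
    so y vanishes on ]0, s]; but y tends to v at 0+. *)
Lemma fundamental_unitmx (n : nat) (A G : R -> 'M[R]_n) (s : R) :
  continuous_pos A -> primitive_pos G (fun t => - (A t *m G t)) ->
  G t @[t --> 0^'+] --> (1%:M : 'M[R]_n) -> 0 < s -> G s \in unitmx.
Proof.
move=> cA GA G0 s0; rewrite -unitmx_tr unitmxE unitfE.
apply/det0P => -[v v0 vG].
pose y t := G t *m v^T.
have ys : y s = 0 by apply: trmx_inj; rewrite /y trmx_mul trmxK vG trmx0.
have yA : primitive_pos y (fun t => - (A t *m y t)).
  move=> t t0.
  apply: (is_derive_eq (is_derive_mulmx (GA t t0) (is_derive_cst v^T t 1))).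
  by rewrite mulmx0 addr0 mulNmx mulmxA.
have y_eq0 := homogeneous_eq0_before cA yA ys.
have yv : y t @[t --> 0^'+] --> v^T.
  by rewrite -[v^T]mul1mx; apply: cvg_mulmx => //; exact: cvg_cst.
have y0 : y t @[t --> 0^'+] --> (0 : 'cV[R]_n).
  have H : (0 : 'cV[R]_n) @[t --> (0 : R)^'+] --> (0 : 'cV[R]_n).
    exact: cvg_cst.
  apply: (near_cvg_to _ H); near=> t; rewrite y_eq0//.
  by near: t; exact: nbhs_right_le.
have vT0 : v^T = 0 by apply: (mx_cvg_unique yv y0).
by move: v0; rewrite -(trmxK v) vT0 trmx0 eqxx.
Unshelve. all: by end_near. Qed.

End Energy.

(** * Variation of constants *)

Section VariationOfConstants.
Context {R : realType}.

Lemma is_solution_primitive (n m : nat) (A : R -> 'M[R]_n)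
    (F : R -> 'M[R]_(n, m)) (y0 : 'M[R]_(n, m)) (y : R -> 'M[R]_(n, m)) :
  is_solution A F y0 y <->
  [/\ y 0 = y0, y t @[t --> 0^'+] --> y0 &
      primitive_pos y (fun t => F t - A t *m y t)].
Proof.
split=> [[-> y0y yF]|[y00 y0y yF]].
  split=> // t t0; have [dy <-] := yF t t0.
  by apply: DeriveDef => //; rewrite derive1E addrK.
split=> //; first by rewrite y00.
move=> t t0; have [dy ey] := yF t t0.
by split=> //; rewrite derive1E ey subrK.
Qed.

Lemma continuous_pos_mulmx (m n p : nat) (M : R -> 'M[R]_(m, n))
    (N : R -> 'M[R]_(n, p)) :
  continuous_pos M -> continuous_pos N ->
  continuous_pos (fun t => M t *m N t).
Proof. by move=> cM cN t t0; apply: cvg_mulmx; [exact: cM|exact: cN]. Qed.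

Lemma continuous_posB (V : normedModType R) (f g : R -> V) :
  continuous_pos f -> continuous_pos g -> continuous_pos (fun t => f t - g t).
Proof. by move=> cf cg t t0; apply: cvgB; [exact: cf|exact: cg]. Qed.

Lemma primitive_pos_continuous (V : normedModType R) (P g : R -> V) :
  primitive_pos P g -> continuous_pos P.
Proof. by move=> Pg t t0; exact: is_derive_continuous (Pg t t0). Qed.

Lemma primitive_pos_mulmxr (m n p : nat) (P g : R -> 'M[R]_(m, n))
    (c : 'M[R]_(n, p)) :
  primitive_pos P g -> primitive_pos (fun t => P t *m c) (fun t => g t *m c).
Proof.
move=> Pg t t0.
apply: (is_derive_eq (is_derive_mulmx (Pg t t0) (is_derive_cst c t 1))).
by rewrite mulmx0 addr0.
Qed.

Lemma primitive_posD (V : normedModType R) (P Q f g : R -> V) :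
  primitive_pos P f -> primitive_pos Q g ->
  primitive_pos (fun t => P t + Q t) (fun t => f t + g t).
Proof. by move=> Pf Qg t t0; apply: is_deriveD; [exact: Pf|exact: Qg]. Qed.

Context {n : nat} {A G : R -> 'M[R]_n}.
Context (cA : continuous_pos A) (hG : is_solution A (fun=> 0) 1%:M G).

Lemma fundamental_primitive : primitive_pos G (fun t => - (A t *m G t)).
Proof.
have /is_solution_primitive[_ _ GA] := hG.
by move=> t t0; apply: is_derive_eq (GA t t0) _; rewrite sub0r.
Qed.

Lemma fundamental_cvg1 : G t @[t --> 0^'+] --> (1%:M : 'M[R]_n).
Proof. by have /is_solution_primitive[] := hG. Qed.

Lemma fundamental_unit (t : R) : 0 < t -> G t \in unitmx.
Proof.
exact: (fundamental_unitmx cA fundamental_primitive fundamental_cvg1).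
Qed.

Lemma invmx_fundamental_cvg1 :
  invmx (G t) @[t --> 0^'+] --> (1%:M : 'M[R]_n).
Proof.
rewrite -[X in _ --> X]invmx1; apply: cvg_invmx; first exact: unitmx1.
exact: fundamental_cvg1.
Qed.

Lemma continuous_pos_invmx_fundamental : continuous_pos (fun t => invmx (G t)).
Proof.
move=> t t0; apply: cvg_invmx; first exact: fundamental_unit.
exact: (primitive_pos_continuous fundamental_primitive).
Qed.

(** The terms in A cancel: (G^-1)' u = - G^-1 G' G^-1 u = G^-1 A u. *)
Lemma pullback_primitive (m : nat) (F u : R -> 'M[R]_(n, m)) :
  primitive_pos u (fun t => F t - A t *m u t) ->
  primitive_pos (fun t => invmx (G t) *m u t) (fun t => invmx (G t) *m F t).
Proof.
move=> uF t t0; have Gu := fundamental_unit t0.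
apply: (is_derive_eq (is_derive_mulmx
  (is_derive_invmx Gu (fundamental_primitive t0)) (uF t t0))).
rewrite !(mulmxN, mulNmx) opprK -!mulmxA (mulmxA (G t)) mulmxV// mul1mx.
by rewrite mulmxBr addrC subrK.
Qed.

(** P - P0 is the integral of G^-1 F from 0. The value at 0 is prescribed
    separately because G is only known to be right-continuous there and P is
    arbitrary at 0. *)
Lemma pushforward_solution (m : nat) (F P : R -> 'M[R]_(n, m))
    (u0 P0 : 'M[R]_(n, m)) :
  primitive_pos P (fun t => invmx (G t) *m F t) ->
  P t @[t --> 0^'+] --> P0 ->
  is_solution A F u0
    (fun t => if t == 0 then u0 else G t *m (u0 + (P t - P0))).
Proof.
move=> PF PP0; apply/is_solution_primitive; rewrite eqxx; split=> //.
- have H : G t *m (u0 + (P t - P0)) @[t --> 0^'+] --> u0.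
    rewrite -[X in _ --> X]mul1mx.
    apply: cvg_mulmx; first exact: fundamental_cvg1.
    rewrite -[X in _ --> X]addr0 -(subrr P0).
    apply: cvgD; first exact: cvg_cst.
    by apply: cvgB => //; exact: cvg_cst.
  apply: (near_cvg_to _ H); near=> t.
  by rewrite gt_eqF//; near: t; exact: nbhs_right_gt.
- move=> t t0; rewrite gt_eqF//.
  have D : is_derive t 1 (fun t => G t *m (u0 + (P t - P0)))
      (F t - A t *m (G t *m (u0 + (P t - P0)))).
    have DP : is_derive t 1 (fun t => u0 + (P t - P0)) (invmx (G t) *m F t).
      apply: (is_derive_eq (is_deriveD (is_derive_cst u0 t 1)
        (is_deriveB (PF t t0) (is_derive_cst P0 t 1)))).
      by rewrite subr0 add0r.
    apply: (is_derive_eq (is_derive_mulmx (fundamental_primitive t0) DP)).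
    rewrite mulNmx -mulmxA (mulmxA (G t) (invmx _)).
    by rewrite mulmxV ?fundamental_unit// mul1mx addrC.
  apply: near_eq_is_derive D; near=> x.
  by rewrite gt_eqF//; near: x; exact: lt_nbhsr.
Unshelve. all: by end_near. Qed.

End VariationOfConstants.

Theorem proposition2 (R : realType) (T : \bar R) (hT : (0 < T)%E) (n : nat)
    (u0 : 'cV[R]_n)
    (A : R -> 'M[R]_n) (hA : {in `]0, +oo[, continuous A})
    (f : R -> 'cV[R]_n) (hf : {in `]0, +oo[, continuous f})
    (G : R -> 'M[R]_n) (hG : is_solution A (fun=> 0) 1%:M G)
    (l : R -> 'M[R]_n) (hl : {in `]0, +oo[, continuous l})
    (hlint : is_integral0 (fun s => invmx (G s) *m l s) T 1%:M)
    (hl0 : forall s : R, (T < s%:E)%E -> l s = 0)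
    (lf : R -> 'cV[R]_n) (hlf : {in `]0, +oo[, continuous lf})
    (hlfT : forall s : R, (T < s%:E)%E -> lf s = f s) :
  let F := fun s : R => f s - l s *m u0 - lf s in
  let controlled :=
    is_integral0 (fun s => invmx (G s) *m (f s - lf s)) T 0 in
  ((forall t : R, 0 < t ->
      exists I, is_integral0 (fun s => invmx (G s) *m F s) t%:E I) ->
    exists u : R -> 'cV[R]_n, is_solution A F u0 u) /\
  (forall u : R -> 'cV[R]_n, is_solution A F u0 u ->
    [/\ (T < +oo)%E ->
          ((forall t : R, (T <= t%:E)%E -> u t = 0) <-> controlled),
        T = +oo%E ->
          (invmx (G t) *m u t @[t --> +oo] --> (0 : 'cV[R]_n) <-> controlled),
        C1_pos u,
        forall t : R, 0 < t ->
          exists2 I, is_integral0 (fun s => invmx (G s) *m F s) t%:E I &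
            u t = G t *m (1%:M *m u0 + I) &
        forall v : R -> 'cV[R]_n, is_solution A F u0 v ->
          forall t : R, 0 <= t -> v t = u t]).
Proof.
move=> F controlled.
have pos_continuous (U : topologicalType) (g : R -> U) :
    {in `]0, +oo[, continuous g} -> continuous_pos g.
  by move=> cg t t0; apply: cg; rewrite in_itv /= t0.
have cA := pos_continuous _ _ hA.
have cGi := continuous_pos_invmx_fundamental cA hG.
have cl := continuous_pos_mulmx cGi (pos_continuous _ _ hl).
have cflf : continuous_pos (fun t => f t - lf t).
  by apply: continuous_posB; apply: pos_continuous.
have cF : continuous_pos F.
  have cl0 : continuous_pos (fun t => l t *m u0).
    apply: continuous_pos_mulmx; first exact: pos_continuous.
    by move=> t _; exact: cvg_cst.
  apply: continuous_posB; last exact: pos_continuous.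
  by apply: continuous_posB => //; exact: pos_continuous.
have cGF := continuous_pos_mulmx cGi cF.
split=> [intF|u uF].
  have [P PF] := exists_primitive_pos cGF.
  have [I FI] := intF 1 ltr01.
  exists (fun t => if t == 0 then u0 else G t *m (u0 + (P t - (P 1 - I)))).
  apply: pushforward_solution => //.
  exact/(is_integral0_finP I cGF PF ltr01).
have pullback0 v : is_solution A F u0 v ->
    invmx (G t) *m v t @[t --> 0^'+] --> u0.
  move=> /is_solution_primitive[_ v0 _]; rewrite -[X in _ --> X]mul1mx.
  by apply: cvg_mulmx => //; exact: invmx_fundamental_cvg1 hG.
have pullbackP v : is_solution A F u0 v ->
    primitive_pos (fun t => invmx (G t) *m v t) (fun t => invmx (G t) *m F t).
  by move=> /is_solution_primitive[_ _ /(pullback_primitive cA hG)].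
have formula v t : is_solution A F u0 v -> 0 < t ->
    exists2 I, is_integral0 (fun s => invmx (G s) *m F s) t%:E I &
      v t = G t *m (1%:M *m u0 + I).
  move=> vF t0; exists (invmx (G t) *m v t - u0).
    apply/(is_integral0_finP _ cGF (pullbackP v vF) t0).
    by rewrite subKr; exact: pullback0.
  rewrite mul1mx addrC subrK mulmxA mulmxV ?mul1mx//.
  exact: (fundamental_unit cA hG).
pose w t := invmx (G t) *m u t.
have w0 : w t @[t --> 0^'+] --> u0 := pullback0 u uF.
have wF : primitive_pos w (fun t => invmx (G t) *m F t) := pullbackP u uF.
have w_eq0 t : 0 < t -> w t = 0 <-> u t = 0.
  move=> t0; rewrite /w; split=> [wt|->]; last by rewrite mulmx0.
  have GV := mulmxV (fundamental_unit cA hG t0).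
  by rewrite -[u t]mul1mx -GV -mulmxA wt mulmx0.
have [L LP] := exists_primitive_pos cl.
pose Q t := L t *m u0 + w t.
have cflfG := continuous_pos_mulmx cGi cflf.
have QP : primitive_pos Q (fun s => invmx (G s) *m (f s - lf s)).
  move=> t t0.
  apply: is_derive_eq (primitive_posD (primitive_pos_mulmxr u0 LP) wF t0) _.
  rewrite -mulmxA -mulmxDr; congr (_ *m _).
  by rewrite /F addrC (addrAC (f t)) subrK.
split.
- case: T hT hl0 hlfT hlint @controlled => [b|//|//].
  rewrite lte_fin => b0 hl0 hlfT hlint controlled _.
  have L0 : L a @[a --> 0^'+] --> L b - 1%:M.
    exact/(is_integral0_finP _ cl LP b0).
  have Q0 : Q a @[a --> 0^'+] --> Q b - w b.
    rewrite /Q addrK.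
    have -> : L b *m u0 = (L b - 1%:M) *m u0 + u0.
      by rewrite mulmxBl mul1mx subrK.
    by apply: cvgD => //; apply: cvg_mulmx => //; exact: cvg_cst.
  have controlledE : controlled <-> w b = 0.
    rewrite /controlled (is_integral0_finP _ cflfG QP b0).
    split=> [Q0'|wb]; last by move: Q0; rewrite wb.
    have Qb : Q b - w b = Q b - 0 := mx_cvg_unique Q0 Q0'.
    by rewrite -(subKr (Q b) (w b)) Qb subKr.
  rewrite controlledE; split=> [u_eq0|wb t].
    by apply/w_eq0 => //; exact: u_eq0.
  rewrite lee_fin => bt; apply/w_eq0; first exact: lt_le_trans bt.
  have F0 s : b < s -> F s = 0.
    by move=> bs; rewrite /F hl0 ?lte_fin// hlfT ?lte_fin// mul0mx subr0 subrr.
  (* At the endpoint b itself the hypotheses give F b = 0 only by continuity. *)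
  have Fb : F b = 0.
    have Fb : F x @[x --> b^'+] --> F b.
      by apply: cvg_at_right_filter; exact: cF.
    have H : (0 : 'cV[R]_n) @[x --> b^'+] --> (0 : 'cV[R]_n) by exact: cvg_cst.
    apply: (mx_cvg_unique Fb); apply: (near_cvg_to _ H); near=> x.
    by rewrite F0//; near: x; exact: nbhs_right_gt.
  have : w t - w b = 0; last by rewrite wb subr0.
  rewrite -(mx_integral_primitive_pos cGF wF b0 bt).
  apply/matrixP => i j; rewrite !mxE (@eq_Rintegral _ _ _ _ _ (cst 0)).
    by rewrite Rintegral_cst// mul0r.
  move=> s; rewrite inE /= in_itv /= le_eqVlt => /andP[/predU1P[<-|bs] _].
    by rewrite Fb mulmx0 mxE.
  by rewrite F0// mulmx0 mxE.
- move=> Toy; rewrite /controlled; subst T.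
  have /(is_integral0_pinftyP _ cl LP)[L0 LL0 Loo] := hlint.
  have Q0 : Q a @[a --> 0^'+] --> L0 *m u0 + u0.
    by apply: cvgD => //; apply: cvg_mulmx => //; exact: cvg_cst.
  have Loo' : L a *m u0 @[a --> +oo] --> L0 *m u0 + u0.
    rewrite -[X in _ + X]mul1mx -mulmxDl.
    by apply: cvg_mulmx => //; exact: cvg_cst.
  rewrite (is_integral0_pinftyP _ cflfG QP); split=> [woo|[Q0' QQ0' Qoo]].
    exists (L0 *m u0 + u0); first exact: Q0.
    exact: (cvgD Loo' woo).
  have E := mx_cvg_unique Q0 QQ0'.
  have H : Q a - L a *m u0 @[a --> +oo] --> (0 : 'cV[R]_n).
    rewrite -[X in _ --> X](subrr (L0 *m u0 + u0)) {1}E -[Q0']addr0.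
    exact: (cvgB Qoo Loo').
  by apply: (near_cvg_to _ H); near=> a; rewrite /Q addrC addKr.
- have /is_solution_primitive[_ _ uA] := uF.
  split=> [t t0|t]; first by case: (uA t t0).
  rewrite in_itv /= andbT => t0.
  have cFA : continuous_pos (fun x => F x - A x *m u x).
    apply: (continuous_posB cF); apply: (continuous_pos_mulmx cA).
    exact: primitive_pos_continuous uA.
  have dE x : 0 < x -> F x - A x *m u x = derive1 u x.
    by move=> x0; rewrite derive1E; case: (uA x x0).
  rewrite /continuous_at -dE//; apply: (near_cvg_to _ (cFA t t0)); near=> x.
  by apply: dE; near: x; exact: lt_nbhsr.
- by move=> t t0; exact: formula.
- move=> v vF t; rewrite le_eqVlt => /predU1P[<-|t0].
    by case: vF => -> _ _; case: uF => -> _ _.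
  have [I FI ->] := formula v t vF t0; have [J FJ ->] := formula u t uF t0.
  by rewrite (mx_cvg_unique FI FJ).
Unshelve. all: by end_near. Qed.
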